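(* Let $N:[0,+\infty)\to[0,+\infty)$ be increasing and convex. Let $f:[0,+\infty)\to[0,+\infty)$ be a decreasing, integrable, log-concave function with $\int_0^{+\infty}f(t)\,dt>0$. If $h>0$ is such that $$\int_0^hf(t)\,dt\leq\frac12\int_0^{+\infty}f(t)\,dt,$$ then $$\int_0^{+\infty}N(t)f(t)\,dt\geq\frac{\int_0^hf(t)\,dt}{h}\int_0^{\frac{h\int_0^{+\infty}f(t)\,dt}{\int_0^hf(t)\,dt}}N(t)\,dt.$$ Equality holds for $f(t)=c\chi_{[0,d]}(t)$, with $c>0$ and $d\geq h$.
   Context: ''Increasing'' and ''decreasing'' are meant in the non-strict sense. A function $f:[0,+\infty)\to[0,+\infty)$ is log-concave if $f((1-\tau)x+\tau y)\geq f(x)^{1-\tau}f(y)^{\tau}$ for all $x,y\geq 0$ and $\tau\in(0,1)$. $\chi_A$ denotes the indicator function of $A$. Integrability is with respect to Lebesgue measure; the left-hand integral may equal $+\infty$. *)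

(* Defs.v *)
From mathcomp Require Import all_boot all_order all_algebra.
From mathcomp Require Import all_classical all_reals all_analysis.

Set Implicit Arguments.
Unset Strict Implicit.
Unset Printing Implicit Defensive.

Import Order.TTheory GRing.Theory Num.Theory.
Import numFieldNormedType.Exports.

Local Open Scope classical_set_scope.
Local Open Scope ring_scope.

(* A function [0, +oo) -> [0, +oo) is represented by a function R -> R that is
   nonnegative on [0, +oo[; its values on the negative reals are irrelevant. *)
Definition nonneg_on_halfline (R : realType) (f : R -> R) : Prop :=
  {in `[0, +oo[, forall x, 0 <= f x}.

Definition increasing_on_halfline (R : realType) (f : R -> R) : Prop :=
  {in `[0, +oo[ &, {homo f : x y / x <= y}}.

Definition decreasing_on_halfline (R : realType) (f : R -> R) : Prop :=
  {in `[0, +oo[ &, {homo f : x y /~ x <= y}}.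

(* Zero values need no special treatment: 0 `^ a = 0 for 0 < a. *)
Definition log_concave_on_halfline (R : realType) (f : R -> R) : Prop :=
  {in `[0, +oo[ &, forall x y (tau : R), 0 < tau < 1 ->
     f x `^ (1 - tau) * f y `^ tau <= f ((1 - tau) * x + tau * y)}.

Section integrals.
Context (R : realType).
Local Notation mu := (@lebesgue_measure R).

Definition mass (f : R -> R) : R := \int[mu]_(t in `[0, +oo[) f t.

Definition mass_upto (h : R) (f : R -> R) : R := \int[mu]_(t in `[0, h]) f t.

Local Open Scope ereal_scope.

Definition weighted_integral (N f : R -> R) : \bar R :=
  \int[mu]_(t in `[0%R, +oo[) (N t * f t)%:E.

Definition lower_bound (N f : R -> R) (h : R) : \bar R :=
  (mass_upto h f / h)%:E *
  \int[mu]_(t in `[0%R, (h * mass f / mass_upto h f)%R]) (N t)%:E.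

End integrals.

(* Main.v *)
Require Import Defs.
From mathcomp Require Import all_boot all_order all_algebra.
From mathcomp Require Import all_classical all_reals all_analysis.
From mathcomp Require Import measurable_realfun ring lra.
Import Order.TTheory GRing.Theory Num.Theory.
Import numFieldNormedType.Exports.
Set Implicit Arguments.
Unset Strict Implicit.
Unset Printing Implicit Defensive.
Local Open Scope classical_set_scope.
Local Open Scope ring_scope.

(** Write [F] for the mass of [f], [a] for its mass on [[0, h]], [A = a / h]
    for its mean value there and [T = h F / a], so that [A T = F]; the
    assumption [a <= F / 2] says that [2 h <= T].  The lower bound is the
    integral of [N g] for the step function [g = A * \1_[0, T]], which has the
    same mass as [f] on [[0, h]] and on [[h, +oo[].  The inequality is thus a
    comparison of [f] with [g] in the increasing convex order.

    Since [f] decreases and has mean [A] on [[0, h]], the difference [f - g]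
    has signs +, -, +, the changes being at some [x0 <= h] and at [T].  Let
    [L t = al + m * t] be the chord of [N] through [x0] and [T]; convexity
    gives [N - L] the same signs (lemma [convex_chord]), so
    [N (f - g) >= L (f - g)] pointwise, and [m >= 0] as [N] increases.  The
    constant part of [L] integrates to [0] against [f - g], hence it remains to
    see that the first moment of [f] is at least that of [g].  Put [b = f h],
    so [b <= A].  Monotonicity gives [t (f - b) >= 0] on [[0, h]] and
    [(t - T) (f - b) >= 0] on [[h, T]], while [(t - T) f >= 0] beyond [T].
    Integrating, and using that [f] and [g] have equal masses on each side of
    [h], the difference of the moments is at least
    [(A - b) * (T - h) ^ 2 / 2 - (A - b) * h ^ 2 / 2], which is nonnegative
    because [T - h >= h].

    All of this is done under the integral sign: the pointwise inequalities
    are added up first, into a minorant of [N f] (lemma [crossing_minorant])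
    that is a linear combination of six integrable functions, and only that
    minorant is integrated term by term. *)

(** * Integrals over the half-line *)

(** Integrability and value go together so that a linear combination can be
    integrated by assembling the facts about its terms. *)
Definition has_integral (R : realType) (f : R -> R) (v : R) : Prop :=
  (@lebesgue_measure R).-integrable `[0, +oo[ (EFin \o f) /\
  \int[lebesgue_measure]_(t in `[0, +oo[) f t = v.

Lemma has_integralZ (R : realType) (k : R) (f : R -> R) (v : R) :
  has_integral f v -> has_integral (fun t => k * f t) (k * v).
Proof.
move=> [fi fv]; split; last by rewrite RintegralZl// fv.
exact: (integrableZl _ k fi).
Qed.

Lemma has_integralD (R : realType) (f g : R -> R) (v w : R) :
  has_integral f v -> has_integral g w ->
  has_integral (fun t => f t + g t) (v + w).
Proof.
move=> [fi fv] [gi gw]; split; last by rewrite RintegralD// fv gw.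
exact: (integrableD _ fi gi).
Qed.

Lemma has_integralB (R : realType) (f g : R -> R) (v w : R) :
  has_integral f v -> has_integral g w ->
  has_integral (fun t => f t - g t) (v - w).
Proof.
move=> [fi fv] [gi gw]; split; last by rewrite RintegralB// fv gw.
exact: (integrableB _ fi gi).
Qed.

(** Functions given on different intervals [[0, d]] become functions on one
    domain, where they can be added. *)
Lemma has_integral_indic (R : realType) (f : R -> R) (d : R) :
  (@lebesgue_measure R).-integrable `[0, d] (EFin \o f) ->
  has_integral (fun t => f t * \1_(`[0, d] : set R) t)
    (\int[lebesgue_measure]_(t in `[0, d]) f t).
Proof.
move=> fi.
have -> : (fun t => f t * \1_(`[0, d] : set R) t) = f \_ `[0, d].
  by rewrite patch_indic.
have sub : `[0, d] `<=` (`[0, +oo[ : set R).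
  by move=> t /=; rewrite !in_itv/= andbT => /andP[].
split; last by rewrite -Rintegral_mkcondr; congr Rintegral; exact/setIidPr.
apply: (@integrableS _ _ _ _ setT) => //.
by rewrite -restrict_EFin; exact: (proj1 (integrable_mkcond _ _) fi).
Qed.

(** [N * f] may have infinite integral and [K] may change sign: the comparison
    is made between [N * f] and the positive part of [K]. *)
Lemma weighted_integral_ge (R : realType) (N f K : R -> R) (v : R) :
  nonneg_on_halfline N -> nonneg_on_halfline f ->
  measurable_fun (`[0, +oo[ : set R) N -> measurable_fun (`[0, +oo[ : set R) f ->
  has_integral K v ->
  (forall t, 0 <= t -> K t <= N t * f t) ->
  (v%:E <= weighted_integral N f)%E.
Proof.
move=> N0 f0 mN mf [Ki <-] KNf; rewrite /weighted_integral fineK; last first.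
  exact: integrable_fin_num.
rewrite [leLHS]integralE.
have mK := measurable_int _ Ki.
apply: (@le_trans _ _ (\int[lebesgue_measure]_(x in `[0%R, +oo[)
    ((fun t => (K t)%:E)^\+ x))%E).
  by rewrite leeBlDr ?integrable_neg_fin_num// leeDl// integral_ge0.
apply: ge0_le_integral => //.
- exact: measurable_funepos.
- by apply/measurable_EFinP; exact: measurable_funM.
- move=> x; rewrite /= in_itv/= andbT => x0.
  have xD : x \in `[0, +oo[ by rewrite in_itv/= x0.
  by rewrite funeposE/= ge_max !lee_fin KNf//= mulr_ge0// ?N0 ?f0.
Qed.

Lemma increasing_measurable (R : realType) (N : R -> R) :
  increasing_on_halfline N -> measurable_fun (`[0, +oo[ : set R) N.
Proof.
move=> Ni.
(* Extending [N] by the constant [N 0] makes it monotone on the whole line. *)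
pose N' (t : R) := N (Num.max 0 t).
have NN' : {in (`[0, +oo[%classic : set R), N' =1 N}.
  move=> t; rewrite inE/= in_itv/= andbT => t0.
  by congr N; exact/max_idPr.
apply: (eq_measurable_fun N' NN').
apply: nondecreasing_measurable => // s t st; apply: Ni.
- by rewrite in_itv/= andbT le_max lexx.
- by rewrite in_itv/= andbT le_max lexx.
- by rewrite ge_max !le_max lexx st orbT.
Qed.

Lemma increasing_integrable (R : realType) (N : R -> R) (d : R) :
  nonneg_on_halfline N -> increasing_on_halfline N ->
  (@lebesgue_measure R).-integrable `[0, d] (EFin \o N).
Proof.
move=> N0 Ni; apply: measurable_bounded_integrable => //.
- by rewrite /= lebesgue_measure_itv/=; case: ifPn => //; rewrite -EFinD ltry.
- apply: measurable_funS (increasing_measurable _) => //.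
  by move=> t /=; rewrite !in_itv/= andbT => /andP[].
- exists (N d); split; first exact: num_real.
  move=> M dM t /=; rewrite in_itv/= => /andP[t0 td].
  rewrite ger0_norm ?N0 ?in_itv/= ?t0//; apply: (le_trans _ (ltW dM)).
  by apply: Ni => //; rewrite in_itv/= ?t0// (le_trans t0).
Qed.

Lemma Rintegral_id (R : realType) (d : R) : 0 < d ->
  \int[@lebesgue_measure R]_(t in `[0, d]) t = d ^+ 2 / 2.
Proof.
move=> d0; rewrite /Rintegral.
have F' (x : R) : is_derive x 1 (fun y : R => 2^-1 * y ^+ 2) x.
  apply: is_derive_eq.
  by rewrite /GRing.scale/=; lra.
rewrite (@continuous_FTC2 _ _ (fun y : R => 2^-1 * y ^+ 2)) //=.
- by rewrite expr0n/= mulr0 subr0 mulrC.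
- apply: continuous_subspaceT => x; exact: cvg_id.
- have c : continuous (fun y : R => 2^-1 * y ^+ 2).
    by move=> x; apply: differentiable_continuous; apply/derivable1_diffP.
  split => //.
  + exact/cvg_at_right_filter/c.
  + exact/cvg_at_left_filter/c.
- by move=> x _; rewrite derive1E; exact: derive_val.
Qed.

Lemma integrable_id (R : realType) (d : R) :
  (@lebesgue_measure R).-integrable `[0, d] (EFin \o (fun t => t)).
Proof.
apply: increasing_integrable.
- by move=> t; rewrite in_itv/= andbT.
- by move=> s t.
Qed.

Lemma Rintegral_itv0_cst (R : realType) (d k : R) : 0 <= d ->
  \int[@lebesgue_measure R]_(t in `[0, d]) k = k * d.
Proof.
move=> d0; rewrite Rintegral_cst//= lebesgue_measure_itv/= lte_fin.
by case: ltgtP d0 => //= [_|<-] _; rewrite ?subr0// oppr0 addr0.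
Qed.

Lemma indic_itv0 (R : realType) (d t : R) : 0 <= t ->
  \1_(`[0, d] : set R) t = (t <= d)%R%:R :> R.
Proof. by move=> t0; rewrite indicE mem_setE in_itv/= t0. Qed.

Lemma has_integral_itv (R : realType) (d : R) : 0 <= d ->
  has_integral (\1_(`[0, d] : set R) : R -> R) d.
Proof.
move=> d0; have : (@lebesgue_measure R).-integrable `[0, d] (EFin \o (fun=> 1 : R)).
  exact: increasing_integrable.
move=> /has_integral_indic; rewrite Rintegral_itv0_cst// mul1r.
by under eq_fun do rewrite mul1r.
Qed.

Lemma lower_boundE (R : realType) (N f : R -> R) (h : R) :
  nonneg_on_halfline N -> increasing_on_halfline N ->
  lower_bound N f h = (mass_upto h f / h *
    \int[lebesgue_measure]_(t in `[0%R, (h * mass f / mass_upto h f)%R]) N t)%:E.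
Proof.
move=> N0 Ni; rewrite /lower_bound [RHS]EFinM; congr (_ * _)%E.
rewrite /Rintegral fineK//.
exact: (integrable_fin_num _ (increasing_integrable _ N0 Ni)).
Qed.

(** * Sign patterns of a convex and of a decreasing function *)

Lemma convex_three_points (R : realType) (N : R -> R) (x y z : R) :
  convex_function (`[0, +oo[%classic : set R) N ->
  0 <= x -> x <= y -> y <= z -> x < z ->
  (z - x) * N y <= (z - y) * N x + (y - x) * N z.
Proof.
move=> Nc x0 xy yz xz.
have zx0 : 0 < z - x by rewrite subr_gt0.
have t01 : 0 <= (z - y) / (z - x) <= 1.
  by rewrite divr_ge0 ?subr_ge0 ?(ltW xz)//= ler_pdivrMr// mul1r lerB.
pose t : {i01 R} := Itv01 (proj1 (andP t01)) (proj2 (andP t01)).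
have /(_ x z) := Nc t.
rewrite !inE/= !in_itv/= !andbT => /(_ x0 (le_trans x0 (ltW xz))).
rewrite !convRE /= /unstable.onem.
have -> : 1 - (z - y) / (z - x) = (y - x) / (z - x) by field; rewrite gt_eqF.
rewrite [X in N X](_ : _ = y); last first.
  rewrite /conv/= /unstable.onem /GRing.scale/=.
  by field; rewrite gt_eqF.
rewrite -(ler_pM2l zx0) => /le_trans; apply.
rewrite le_eqVlt; apply/orP; left; apply/eqP; field; by rewrite gt_eqF.
Qed.

(** The line is the chord of [N] through [x] and [z]; each of the three
    comparisons is convexity applied to [t], [x] and [z] in their order. *)
Lemma convex_chord (R : realType) (N : R -> R) (x z : R) :
  increasing_on_halfline N ->
  convex_function (`[0, +oo[%classic : set R) N ->
  0 <= x -> x < z ->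
  exists al m : R, [/\ 0 <= m,
    (forall t, 0 <= t -> t <= x -> al + m * t <= N t),
    (forall t, x <= t -> t <= z -> N t <= al + m * t) &
    (forall t, z <= t -> al + m * t <= N t)].
Proof.
move=> Ni Nc x0 xz.
have zx0 : 0 < z - x by rewrite subr_gt0.
have zx_neq0 : z - x != 0 by rewrite gt_eqF.
pose m := (N z - N x) / (z - x).
have mE : m * (z - x) = N z - N x by rewrite /m divfK.
have NxE : N z = N x + m * (z - x) by rewrite mE; lra.
exists (N x - m * x), m; split.
- rewrite divr_ge0 ?subr_ge0 ?(ltW xz)//.
  by apply: Ni; rewrite ?in_itv/= ?andbT// ?(ltW xz)// (le_trans x0 (ltW xz)).
- move=> t t0 tx.
  have := convex_three_points Nc t0 tx (ltW xz) (le_lt_trans tx xz).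
  rewrite NxE => H; rewrite -(ler_pM2l zx0); nra.
- move=> t xt tz.
  have := convex_three_points Nc x0 xt tz xz.
  rewrite NxE => H; rewrite -(ler_pM2l zx0); nra.
- move=> t zt.
  have := convex_three_points Nc x0 (ltW xz) zt (lt_le_trans xz zt).
  rewrite NxE => H; rewrite -(ler_pM2l zx0); nra.
Qed.

(** The crossing point is the supremum of the points where [f] exceeds [A]; no
    such point lies beyond [h].  The inequalities are stated away from the
    crossing point because [f] may jump there to either side of [A]. *)
Lemma decreasing_crossing (R : realType) (f : R -> R) (h A : R) :
  decreasing_on_halfline f -> 0 <= h -> f h <= A ->
  exists x, [/\ 0 <= x, x <= h,
    (forall t, 0 <= t -> t < x -> A <= f t) &
    (forall t, x < t -> f t <= A)].
Proof.
move=> fd h0 fhA.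
(* [0] is put into [S] so that it is nonempty even if [f] never exceeds [A]. *)
pose S := [set t : R | t = 0 \/ 0 <= t /\ A < f t].
have Sh : ubound S h.
  move=> t [->//|[t0 Aft]]; rewrite leNgt; apply/negP => ht.
  have : f t <= f h by apply: fd; rewrite ?in_itv/= ?andbT// ltW.
  by rewrite leNgt (le_lt_trans fhA Aft).
have S0 : S 0 by left.
have supS : has_sup S by split; [exists 0|exists h].
exists (sup S); split.
- by apply: ub_le_sup => //; exists h.
- by apply: ge_sup => //; exists 0.
- move=> t t0 /(sup_gt (ex_intro _ 0 S0)) [s + ts].
  case=> [s0|[s0 /ltW Afs]]; first by move: ts; rewrite s0 ltNge t0.
  apply: (le_trans Afs); apply: fd; rewrite ?in_itv/= ?andbT//.
  exact: ltW.
- move=> t; apply: contraTT; rewrite -!ltNge -leNgt => Aft.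
  have [t0|t0] := leP 0 t.
    by apply: ub_le_sup; [exists h|right].
  by apply: (le_trans (ltW t0)); apply: ub_le_sup => //; exists h.
Qed.

(** * The inequality *)

(** The pointwise inequality behind the theorem, at a point [t] where [N] and
    [f] take the values [n] and [ft].  With [g = A * \1_[0, T]] the left-hand
    side is [n g + al (f - g) + m K], where [K] bounds [t (f - g)] from below:
    [K] is [- (A - b) t] on [[0, h]],
    [T (f - A) + (A - b) (T - t)] on []h, T]] and [T f] beyond [T].  Each of its
    terms has an integral that is known exactly, which is not the case for
    [t (f - g)]. *)
Lemma crossing_minorant (R : realType) (n ft al m A b h T t : R) :
  0 <= m -> 0 <= ft -> 0 <= (n - (al + m * t)) * (ft - A * (t <= T)%R%:R) ->
  0 <= t -> h <= T ->
  (t <= h -> b <= ft) -> (h <= t -> ft <= b) ->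
  A * (n * (t <= T)%R%:R) + al * (ft - A * (t <= T)%R%:R)
  + m * T * ((ft - A * (t <= T)%R%:R) - (ft * (t <= h)%R%:R - A * (t <= h)%R%:R))
  + m * (A - b) * (T * ((t <= T)%R%:R - (t <= h)%R%:R) - t * (t <= T)%R%:R)
  <= n * ft.
Proof.
move=> m0 ft0 NL t0 hT bf fb.
have [th|ht] := leP t h.
  move: NL; rewrite (le_trans th hT) mulr1n => NL.
  have : 0 <= m * (t * (ft - b)) by rewrite !mulr_ge0// subr_ge0 bf.
  lra.
move: NL; have [tT|Tt] := leP t T.
  rewrite mulr0n mulr1n => NL.
  have : 0 <= m * ((T - t) * (b - ft)) by rewrite !mulr_ge0// subr_ge0// fb// ltW.
  lra.
rewrite !mulr0n => NL.
have : 0 <= m * ((t - T) * ft) by rewrite !mulr_ge0// subr_ge0 ltW.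
lra.
Qed.

Lemma lower_bound_le_weighted_integral (R : realType) (N f : R -> R) (h : R) :
  0 < h ->
  nonneg_on_halfline N -> increasing_on_halfline N ->
  convex_function (`[0, +oo[%classic : set R) N ->
  nonneg_on_halfline f -> decreasing_on_halfline f ->
  (@lebesgue_measure R).-integrable `[0, +oo[ (EFin \o f) ->
  0 < mass f -> mass_upto h f <= 2^-1 * mass f ->
  (lower_bound N f h <= weighted_integral N f)%E.
Proof.
move=> h0 N0 Ni Nc f0 fd fi F0 aF2.
have fih : (@lebesgue_measure R).-integrable `[0, h] (EFin \o f).
  apply: integrableS fi => // t /=.
  by rewrite !in_itv/= andbT => /andP[].
have hf_h : has_integral (fun t => f t * \1_(`[0, h] : set R) t) (mass_upto h f).
  exact: has_integral_indic.
set F := mass f in F0 aF2 *; set a := mass_upto h f in aF2 hf_h *.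
pose b := f h.
have b0 : 0 <= b by apply: f0; rewrite in_itv/= ltW.
have hab : b * h <= a.
  rewrite -(Rintegral_itv0_cst b (ltW h0)); apply: le_Rintegral => //.
    by apply: increasing_integrable => // t _.
  move=> t /=; rewrite in_itv/= => /andP[t0 th].
  by apply: fd; rewrite // in_itv/= ?t0// ltW.
have a0 : 0 < a.
  rewrite ltNge; apply/negP => a_le0.
  (* Without mass on [[0, h]], [f] would vanish at [h], hence beyond [h], so
     that all of its mass would be on [[0, h]]. *)
  have b_eq0 : b = 0 by apply/le_anti; rewrite b0 -(pmulr_lle0 _ h0) mulrC; lra.
  have : F = a.
    rewrite -(hf_h.2); apply: eq_Rintegral => t; rewrite inE/= in_itv/= andbT => t0.
    rewrite indic_itv0//; have [th|ht] := leP t h; first by rewrite mulr1.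
    rewrite mulr0; apply/le_anti; rewrite f0 ?in_itv/= ?t0// andbT -b_eq0.
    by apply: fd; rewrite ?in_itv/= ?t0 ?andbT// ltW.
  lra.
pose A := a / h; pose T := h * F / a.
have A0 : 0 < A by rewrite divr_gt0.
have aE : a = A * h by rewrite /A divfK// gt_eqF.
have FE : F = A * T by rewrite /A /T; field; rewrite !gt_eqF.
have h2T : 2 * h <= T.
  by rewrite -(ler_pM2l A0) -FE; lra.
have hT : h <= T by lra.
have T0 : 0 < T by lra.
have bA : b <= A by rewrite -(ler_pM2r h0) -aE.
have [x0 [x00 x0h fx0 x0f]] := decreasing_crossing fd (ltW h0) bA.
have x0T : x0 < T by lra.
have [al [m [m0 Lx0 LxT LT]]] := convex_chord Ni Nc x00 x0T.
pose IN := \int[lebesgue_measure]_(t in `[0, T]) N t.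
have iN := increasing_integrable T N0 Ni.
have hf : has_integral f F by split.
have h1 := @has_integral_itv R.
have hid := has_integral_indic (integrable_id T).
rewrite Rintegral_id// in hid.
have hN := has_integral_indic iN.
have hg := has_integralB hf (has_integralZ A (h1 T (ltW T0))).
have hgh := has_integralB hf_h (has_integralZ A (h1 h (ltW h0))).
have hpsi := has_integralB
  (has_integralZ T (has_integralB (h1 T (ltW T0)) (h1 h (ltW h0)))) hid.
have hK := has_integralD (has_integralD (has_integralD
  (has_integralZ A hN) (has_integralZ al hg))
  (has_integralZ (m * T) (has_integralB hg hgh)))
  (has_integralZ (m * (A - b)) hpsi).
rewrite lower_boundE// -/a -/F -/A -/T.
apply: le_trans (weighted_integral_ge N0 f0 _ _ hK _).
- rewrite lee_fin FE aE -/IN.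
  (* All terms but the first and the last cancel, and the integral of
     [T * \1_]h, T] - t * \1_[0, T]] is [T * (T - 2 * h) / 2]. *)
  have : 0 <= m * (A - b) * (T * (T - 2 * h)).
    by apply: mulr_ge0; apply: mulr_ge0; rewrite ?subr_ge0// ltW.
  lra.
- exact: increasing_measurable.
- by apply/measurable_EFinP; exact: measurable_int fi.
- move=> t t0; rewrite !indic_itv0//.
  have ft0 : 0 <= f t by apply: f0; rewrite in_itv/= t0.
  apply: crossing_minorant => //.
  + (* [N - L] and [f - g] have the same sign. *)
    have [tT|Tt] := leP t T; last first.
      by rewrite mulr0n mulr0 subr0 mulr_ge0// subr_ge0 LT// ltW.
    rewrite mulr1n mulr1; case: (ltgtP t x0) => [tx|xt|tx].
    * by rewrite mulr_ge0// subr_ge0 ?fx0// Lx0// ltW.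
    * by rewrite mulr_le0// subr_le0 ?x0f// LxT// ltW.
    * (* at the crossing point the chord meets [N] *)
      suff -> : N t = al + m * t by rewrite subrr mul0r.
      by apply/le_anti; rewrite LxT ?Lx0// tx.
  + by move=> th; apply: fd; rewrite // in_itv/= ?t0// ltW.
  + by move=> th; apply: fd; rewrite // in_itv/= ?t0// ltW.
Qed.

(** For a step function of height [c] on [[0, d]], the mean on [[0, h]] is [c]
    and the abscissa [T] is [d]: here [g] is [f] itself. *)
Lemma weighted_integral_step (R : realType) (N : R -> R) (h c d : R) :
  nonneg_on_halfline N -> increasing_on_halfline N ->
  0 < h -> 0 < c -> h <= d ->
  let f := fun t : R => c * \1_(`[0, d]%classic : set R) t in
  weighted_integral N f = lower_bound N f h.
Proof.
move=> N0 Ni h0 c0 hd f; have d0 := lt_le_trans h0 hd.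
have FE : mass f = c * d.
  exact: (has_integralZ c (has_integral_itv (ltW d0))).2.
have aE : mass_upto h f = c * h.
  rewrite -(Rintegral_itv0_cst c (ltW h0)); apply: eq_Rintegral => t.
  rewrite inE/= in_itv/= => /andP[t0 th]; rewrite /f indic_itv0//.
  by rewrite (le_trans th hd) mulr1.
rewrite lower_boundE// FE aE mulfK ?gt_eqF//.
have -> : h * (c * d) / (c * h) = d by field; rewrite !gt_eqF.
have [hNi <-] := has_integralZ c
  (has_integral_indic (increasing_integrable d N0 Ni)).
rewrite /Rintegral fineK; last exact: integrable_fin_num.
by apply: eq_integral => t _; rewrite /f mulrCA.
Qed.

Theorem theorem1p3 (R : realType) (N : R -> R) (h : R)
  (N_ge0 : nonneg_on_halfline N)
  (N_incr : increasing_on_halfline N)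
  (N_convex : convex_function (`[0, +oo[%classic : set R) N)
  (h_gt0 : 0 < h) :
  (forall f : R -> R,
     nonneg_on_halfline f ->
     decreasing_on_halfline f ->
     (@lebesgue_measure R).-integrable `[0, +oo[ (EFin \o f) ->
     log_concave_on_halfline f ->
     0 < mass f ->
     mass_upto h f <= 2^-1 * mass f ->
     (lower_bound N f h <= weighted_integral N f)%E) /\
  (forall c d : R, 0 < c -> h <= d ->
     let f := fun t : R => c * \1_(`[0, d]%classic : set R) t in
     weighted_integral N f = lower_bound N f h).
Proof.
split; first by move=> f f0 fd fi _; exact: lower_bound_le_weighted_integral.
by move=> c d c0 hd; exact: weighted_integral_step.
Qed.
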